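(* Let $X_1,X_2,\dots$ be i.i.d. real-valued random variables and let $X^{(n)}=(X_1,\dots,X_n)$. Suppose that $\Lambda(t):=\log\mathbb E[e^{tX_1^2}]<\infty$ for $t$ in some open ball of non-zero radius about $0$, and let $\Lambda^*(x)=\sup_{t\in\mathbb R}\{xt-\Lambda(t)\}$. Then $\{\|X^{(n)}\|_2/\sqrt n\}_{n\in\mathbb N}$ satisfies an LDP in $\mathbb R$ at speed $n$ with GRF $J_X(x)=\Lambda^*(x^2)$ for $x\in\mathbb R_+=[0,\infty)$ and $J_X(x)=+\infty$ otherwise. Moreover, $m=\sqrt{\mathbb E[|X_1|^2]}$ is the unique minimizer of $J_X$.
   Context: LDP: a sequence of random variables $\{\eta_n\}$ with values in a regular topological space $\mathcal X$ satisfies a large deviation principle (LDP) at speed $s_n$ (positive reals with $s_n\to\infty$) with rate function $I:\mathcal X\to[0,\infty]$ if $I$ is lower semicontinuous and for every Borel set $\Gamma$, $-\inf_{\Gamma^\circ}I\le\liminf_n\frac1{s_n}\log\mathbb P(\eta_n\in\Gamma)\le\limsup_n\frac1{s_n}\log\mathbb P(\eta_n\in\Gamma)\le-\inf_{\bar\Gamma}I$. It is a good rate function (GRF) if moreover its level sets are compact. *)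

(* Defs.v *)
From HB Require Import structures.
From mathcomp Require Import all_boot all_order all_algebra.
From mathcomp Require Import all_classical all_reals all_analysis.

Set Implicit Arguments.
Unset Strict Implicit.
Unset Printing Implicit Defensive.

Import Order.TTheory GRing.Theory Num.Theory.
Import numFieldNormedType.Exports.

Local Open Scope classical_set_scope.
Local Open Scope ring_scope.

Definition borel (S : topologicalType) : set (set S) :=
  <<s [set A : set S | open A] >>.

(* Sequences are indexed by n >= 1: the speed is not constrained at n = 0, and
   the limits below do not see that index. The usual assumption that S is a
   regular space plays no role in the definition itself. *)
Definition speed (R : realType) (s : nat -> R) : Prop :=
  (forall n, (0 < n)%N -> 0 < s n) /\ (s n @[n --> \oo] --> +oo).

Definition rate_function (R : realType) (S : topologicalType)
    (I : S -> \bar R) : Prop :=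
  (forall x, (0 <= I x)%E) /\ lower_semicontinuous I.

Definition good_rate_function (R : realType) (S : topologicalType)
    (I : S -> \bar R) : Prop :=
  rate_function I /\ forall c : R, compact [set x | (I x <= c%:E)%E].

Definition log_prob (d : measure_display) (T : measurableType d)
    (R : realType) (P : probability T R) (S : topologicalType)
    (s : nat -> R) (eta : nat -> T -> S) (G : set S) (n : nat) : \bar R :=
  ((s n)^-1%:E * lne (P (eta n @^-1` G)))%E.

Definition LDP (d : measure_display) (T : measurableType d)
    (R : realType) (P : probability T R) (S : topologicalType)
    (s : nat -> R) (eta : nat -> T -> S) (I : S -> \bar R) : Prop :=
  [/\ speed s,
      forall n (G : set S), borel G -> measurable (eta n @^-1` G),
      rate_function I &
      forall G : set S, borel G ->
        [/\ (- ereal_inf (I @` G°) <= limn_einf (log_prob P s eta G))%E,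
            (limn_einf (log_prob P s eta G) <=
               limn_esup (log_prob P s eta G))%E &
            (limn_esup (log_prob P s eta G) <=
               - ereal_inf (I @` closure G))%E]].

Definition mutually_independent (d : measure_display) (T : measurableType d)
    (R : realType) (P : probability T R) (X : nat -> {RV P >-> R}) : Prop :=
  forall (F : seq nat) (B : nat -> set R), uniq F ->
    (forall i, measurable (B i)) ->
    P (\bigcap_(i in [set` F]) X i @^-1` B i) =
      (\prod_(i <- F) P (X i @^-1` B i))%E.

Definition identically_distributed (d : measure_display)
    (T : measurableType d) (R : realType) (P : probability T R)
    (X : nat -> {RV P >-> R}) : Prop :=
  forall (i j : nat) (B : set R), measurable B ->
    distribution P (X i) B = distribution P (X j) B.

Definition iid (d : measure_display) (T : measurableType d) (R : realType)
    (P : probability T R) (X : nat -> {RV P >-> R}) : Prop :=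
  mutually_independent X /\ identically_distributed X.

(* The norm that the library puts on 'rV[R]_n is the sup norm. *)
Definition norm2 (R : realType) (n : nat) (x : 'rV[R]_n) : R :=
  Num.sqrt (\sum_(i < n) `|x ord0 i| ^+ 2).

Definition log_mgf (d : measure_display) (T : measurableType d)
    (R : realType) (P : probability T R) (Y : T -> R) (t : R) : \bar R :=
  lne ('M_P Y t).

Definition legendre (R : realType) (L : R -> \bar R) (x : R) : \bar R :=
  ereal_sup [set ((x * t)%:E - L t)%E | t in [set: R]].

Definition unique_minimizer (R : realType) (S : Type) (f : S -> \bar R)
    (m : S) : Prop :=
  forall x, (forall y, (f x <= f y)%E) <-> x = m.

(* X i stands for the (i+1)-st variable of the sequence. *)
Definition first_coords (d : measure_display) (T : measurableType d)
    (R : realType) (P : probability T R) (X : nat -> {RV P >-> R}) (n : nat)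
    (w : T) : 'rV[R]_n :=
  \row_(i < n) X i w.

Definition J_X (d : measure_display) (T : measurableType d)
    (R : realType) (P : probability T R) (X : nat -> {RV P >-> R})
    (x : R) : \bar R :=
  if 0 <= x then legendre (log_mgf P (fun w => X 0%N w ^+ 2)) (x ^+ 2)
  else +oo%E.

(* Main.v *)
(* The norm is [sqrt (S_n / n)] with [S_n] the sum of the [X_i ^ 2], so both
   bounds are Cramer's theorem for [S_n], read through the square root.

   Upper bound: a closed set is contained in [(-oo, a] U [b, +oo)] with [a], [b]
   its points nearest to the minimizer, and each half-line is handled by
   Chernoff's inequality.

   Lower bound at [v], with [Z = X_0 ^ 2 - v]: suppose [alpha < E e^(t Z)] for
   all [t]. If [Z] takes both signs, truncate [Z] to [|Z| <= k]; for large [k] the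
   truncated generating function [phi] still exceeds [alpha] (compactness) and
   has a global minimizer [t]. A second difference estimate replaces
   [phi' (t) = 0]: it gives [phi (t +- s) e^(- s delta) < phi t] for some [s > 0],
   so that in [phi t ^ n = E prod_i e^(t Z_i)] the part where
   [|sum_i Z_i| >= n delta] is exponentially negligible, and the rest bounds
   [P (|sum_i Z_i| < n delta)] from below. If [Z] has a constant sign, then
   [alpha <= P (|Z| < delta)], and it suffices that all [|Z_i| < delta]. *)

Require Import Defs.
From HB Require Import structures.
From mathcomp Require Import all_boot all_order all_algebra.
From mathcomp Require Import all_classical all_reals all_analysis.
From mathcomp Require Import measurable_realfun.
From mathcomp Require Import ring lra.

Set Implicit Arguments.
Unset Strict Implicit.
Unset Printing Implicit Defensive.

Import Order.TTheory GRing.Theory Num.Theory.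
Import numFieldNormedType.Exports.

Local Open Scope classical_set_scope.
Local Open Scope ring_scope.

(** * Elementary inequalities for the exponential and for geometric sequences *)

Section real_inequalities.
Context (R : realType).
Implicit Types u t z : R.

(** Both sides are even in [u]; for [u >= 0] the left side is [2 + e^u (1 - e^(-u))^2], and
    [0 <= 1 - e^(-u) <= u]. *)
Lemma expR_second_difference_le u : expR u + expR (- u) <= 2 + u ^+ 2 * expR `|u|.
Proof.
wlog u0 : u / 0 <= u => [wl|].
  have [/wl//|/ltW u0] := leP 0 u.
  by have := wl (- u); rewrite opprK sqrrN normrN addrC; apply; rewrite oppr_ge0.
rewrite ger0_norm//; have EF := expRxMexpNx_1 u.
have F1 : expR (- u) <= 1 by rewrite expR_le1 oppr_le0.
have Fu := expR_ge1Dx (- u); have E0 := expR_gt0 u.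
have h : (1 - expR (- u)) ^+ 2 <= u ^+ 2.
  by rewrite ler_sqr ?nnegrE ?subr_ge0//; lra.
have -> : expR u + expR (- u) = 2 + expR u * (1 - expR (- u)) ^+ 2.
  rewrite sqrrB expr1n mul1r !mulrDr mulrN mulr2n mulr1 mulrDr EF expr2 mulrA EF.
  ring.
by rewrite lerD2l [leRHS]mulrC ler_pM2l.
Qed.

Lemma expR_le_quadratic u : expR u <= 1 + u + u ^+ 2 * expR `|u|.
Proof.
have [u0|u0] := leP 0 u.
  rewrite ger0_norm//; have EF := expRxMexpNx_1 u.
  have Fu := expR_ge1Dx (- u); have E0 := expR_gt0 u.
  have EuE : expR u - 1 <= u * expR u.
    have : expR u * (1 - expR (- u)) <= expR u * u.
      by rewrite ler_wpM2l ?(ltW E0)//; lra.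
    by rewrite mulrBr EF mulr1 [leRHS]mulrC.
  have : u * (expR u - 1) <= u * (u * expR u) by rewrite ler_wpM2l.
  rewrite mulrA -expr2; nra.
rewrite ltr0_norm//; have EF := expRxMexpNx_1 u.
have Fu := expR_ge1Dx (- u); have E0 := expR_gt0 u.
have h : u ^+ 2 <= u ^+ 2 * expR (- u).
  by rewrite ler_peMr ?sqr_ge0//; lra.
suff : expR u <= 1 + u + u ^+ 2 by lra.
have : expR u * (1 - u) <= 1 by rewrite -[leRHS]EF ler_wpM2l ?(ltW E0)//; lra.
have : 0 < 1 - u by lra.
move=> p1 p2; rewrite -(ler_pM2r p1); apply: (le_trans p2).
have : 0 <= (- u) * u ^+ 2 by rewrite mulr_ge0 ?sqr_ge0//; lra.
by rewrite !exprS expr0; nra.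
Qed.

(** Both ratios to [c ^+ n] tend to 0. This absorbs constant factors and exponentially smaller terms
    in the two bounds. *)
Lemma near_exprn_lt (a b c e : R) : 0 <= a < c -> 0 <= b < c -> 0 <= e ->
  \forall n \near \oo, a ^+ n + e * b ^+ n <= c ^+ n.
Proof.
move=> /andP[a0 ac] /andP[b0 bc] e0.
have c0 : 0 < c by exact: le_lt_trans ac.
have ratio x : 0 <= x -> x < c -> ((x / c) ^+ n)%R @[n --> \oo] --> (0 : R).
  move=> x0 xc; apply: cvg_expr.
  by rewrite ger0_norm ?divr_ge0 ?(ltW c0)// ltr_pdivrMr// mul1r.
have lim0 : ((a / c) ^+ n + e * (b / c) ^+ n)%R @[n --> \oo] --> (0 + e * 0 : R).
  by apply: cvgD; [exact: ratio|exact: (@cvgMl_tmp _ _ _ _ _ e _ (ratio _ b0 bc))].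
rewrite mulr0 addr0 in lim0.
have {}lim0 := cvgr_lt _ lim0 1 ltr01; near=> n.
have : (a / c) ^+ n + e * (b / c) ^+ n < 1 by near: n; exact: lim0.
by move/ltW; rewrite !expr_div_n mulrA -mulrDl ler_pdivrMr ?exprn_gt0// mul1r.
Unshelve. all: by end_near. Qed.

End real_inequalities.

(** * Expectation of a product of functions of i.i.d. variables *)

Section independence.
Import HBNNSimple.
Context d (T : measurableType d) (R : realType) (P : probability T R).
Variable Y : nat -> {RV P >-> R}.
Hypothesis iidY : iid Y.

Lemma iid_distribution i (A : set R) : measurable A ->
  P (Y i @^-1` A) = P (Y 0%N @^-1` A).
Proof. by move=> mA; have := iidY.2 i 0%N A mA. Qed.

Lemma iid_probability_bigcap n (A : 'I_n -> set R) :
    (forall i, measurable (A i)) ->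
  P (\bigcap_(i in [set: 'I_n]) (Y i @^-1` A i)) =
  (\prod_(i < n) P (Y 0%N @^-1` A i))%E.
Proof.
move=> mA.
(* Independence concerns families indexed by [nat]; indices outside ['I_n] get the whole line. *)
pose B k := if insub k is Some i then A i else setT.
have mB k : measurable (B k) by rewrite /B; case: insubP => // i.
have BA (i : 'I_n) : B i = A i by rewrite /B valK.
have -> : \bigcap_(i in [set: 'I_n]) (Y i @^-1` A i) =
    \bigcap_(k in [set` iota 0 n]) (Y k @^-1` B k).
  apply/seteqP; split => w /= h.
    move=> k /=; rewrite mem_iota /= add0n => kn.
    by have := h (Ordinal kn) I; rewrite /= -BA.
  by move=> i _ /=; rewrite -BA; apply: h; rewrite /= mem_iota /= add0n.
rewrite iidY.1 ?iota_uniq// -[n in iota 0 n]subn0 -/(index_iota 0 n) big_mkord.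
by apply: eq_bigr => i _; rewrite iid_distribution// BA.
Qed.

(** Distributing the product over the sums leaves one term per choice [h] of a set for each index.
    Its product of indicators is that of an intersection, whose probability factorizes; distributing
    backwards gives the power. *)
Lemma iid_integral_prod_indic n m (a : 'I_m -> R) (A : 'I_m -> set R) :
    (forall j, 0 <= a j) -> (forall j, measurable (A j)) ->
  (\int[P]_w (\prod_(i < n) \sum_(j < m) a j * \1_(A j) (Y i w))%:E =
   ((\sum_(j < m) a j * fine (P (Y 0%N @^-1` A j))) ^+ n)%:E)%E.
Proof.
move=> a0 mA.
have mYA i j : measurable (Y i @^-1` A j).
  by rewrite -[_ @^-1` _]setTI; exact: measurable_funPT.
pose D (h : {ffun 'I_n -> 'I_m}) := \bigcap_(i in [set: 'I_n]) (Y i @^-1` A (h i)).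
have mD h : measurable (D h).
  by apply: fin_bigcap_measurable => // i _; exact: mYA.
pose b (h : {ffun 'I_n -> 'I_m}) : R := \prod_(i < n) a (h i).
have b0 h : 0 <= b h by apply: prodr_ge0.
transitivity (\int[P]_w (\sum_(h : {ffun 'I_n -> 'I_m}) (b h * \1_(D h) w)%:E))%E.
  apply: eq_integral => w _; rewrite sumEFin; congr EFin.
  rewrite bigA_distr_bigA; apply: eq_bigr => h _.
  rewrite big_split /=; congr (_ * _).
  rewrite indicE; case: (boolP (w \in D h)) => [|].
    rewrite inE => wD; apply: big1 => i _; rewrite indicE mem_set//; exact: wD.
  rewrite notin_setE => wD.
  have [i iD] : exists i : 'I_n, ~ A (h i) (Y i w).
    by apply/existsNP => H; apply: wD => i _; exact: H.
  by rewrite (bigD1 i)//= indicE memNset// mul0r.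
rewrite ge0_integral_sum//; last 2 first.
- by move=> h; apply/measurable_EFinP; apply: measurable_funM => //; exact: measurable_indic.
- by move=> h w _; rewrite lee_fin mulr_ge0// indicE ler0n.
rewrite -[X in _ ^+ X]card_ord -prodr_const bigA_distr_bigA -sumEFin; apply: eq_bigr => h _.
under eq_integral do rewrite EFinM.
rewrite ge0_integralZl//; last 2 first.
- by apply/measurable_EFinP; exact: measurable_indic.
- by rewrite lee_fin.
rewrite integral_indic// setIT big_split EFinM; congr (_ * _)%E.
apply: etrans (iid_probability_bigcap (fun i => mA (h i))) _.
rewrite -prodEFin; apply: eq_bigr => i _.
by rewrite fineK// fin_num_measure.
Qed.


(** Monotone convergence from simple functions [g k] increasing to [f], for which the identity is
    the preceding lemma. *)
Lemma iid_integral_prod n (f : R -> R) (c : R) :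
    measurable_fun [set: R] f -> (forall x, 0 <= f x) ->
    (\int[P]_w (f (Y 0%N w))%:E = c%:E)%E ->
  (\int[P]_w (\prod_(i < n) f (Y i w))%:E = (c ^+ n)%:E)%E.
Proof.
move=> mf f0 fc.
have mfE : measurable_fun [set: R] (EFin \o f) by exact/measurable_EFinP.
pose g k := nnsfun_approx measurableT mfE k.
have gf x : (g k x)%R @[k --> \oo] --> f x.
  have := @cvg_nnsfun_approx _ _ _ _ measurableT _ mfE (fun x _ => f0 x) x I.
  by move/fine_cvgP => [].
have g_nd x : {homo (fun k => g k x) : k l / (k <= l)%N >-> k <= l}.
  by move=> k l kl; exact/lefP/nd_nnsfun_approx.
have mgY i k : measurable_fun [set: T] (fun w => g k (Y i w)).
  exact: (measurableT_comp (measurable_funPT (g k))).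
have cvg1 n' : (\int[P]_w (\prod_(i < n') g k (Y i w))%:E)%E @[k --> \oo]
    --> (\int[P]_w (\prod_(i < n') f (Y i w))%:E)%E.
  have -> : (\int[P]_w (\prod_(i < n') f (Y i w))%:E =
      \int[P]_w limn (fun k => (\prod_(i < n') g k (Y i w))%:E))%E.
    apply: eq_integral => w _; apply/esym/cvg_lim => //.
    apply: cvg_EFin; first exact: nearW.
    by apply: cvg_big => [|i _]; [exact: mul_continuous|exact: gf].
  apply: cvg_monotone_convergence => //.
  - move=> k; apply/measurable_EFinP; apply: measurable_prod => i _; exact: mgY.
  - by move=> k w _; rewrite lee_fin prodr_ge0.
  - move=> w _ k l kl; rewrite lee_fin; apply: ler_prod => i _.
    by rewrite fun_ge0 /= g_nd.
(* The base [s] does not depend on the number of factors: its limit is identified with a single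
   factor and then used for [n] factors. *)
have simple k : exists s, forall n',
    (\int[P]_w (\prod_(i < n') g k (Y i w))%:E)%E = (s ^+ n')%:E.
  have fing := fimfunP (g k).
  pose r := finmap.enum_fset (fset_set (range (g k))).
  pose a := tnth (in_tuple r).
  have a0 j : 0 <= a j.
    have : a j \in r by exact: mem_tnth.
    by rewrite in_fset_set// inE => -[x _ <-]; exact: fun_ge0.
  have mA j : measurable (g k @^-1` [set a j]).
    by rewrite -[_ @^-1` _]setTI; exact: measurable_funPT.
  eexists => n'; apply: etrans (iid_integral_prod_indic n' a0 mA).
  apply: eq_integral => w _; congr EFin; apply: eq_bigr => i _.
  by rewrite fimfunE fsbig_finite//= big_tnth.
have [s sE] := choice simple.
have sc : s k @[k --> \oo] --> c.
  have := cvg1 1%N; under eq_cvg do rewrite sE expr1.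
  rewrite (_ : integral _ _ _ = c%:E) => [/fine_cvgP[]//|].
  by rewrite -fc; apply: eq_integral => w _; rewrite big_ord1.
have := cvg1 n; under eq_cvg do rewrite sE.
move=> h; apply: (cvg_unique _ h) => //; apply: cvg_EFin; first exact: nearW.
by apply: (@continuous_cvg _ _ _ _ _ _ (fun x : R => x ^+ n)) => //;
  exact: exprn_continuous.
Qed.

End independence.

(** * Moment generating function truncated to [[-k, k]] *)

Section truncated_mgf.
Context d (T : measurableType d) (R : realType) (P : probability T R).
Variable Z : T -> R.
Hypothesis mZ : measurable_fun [set: T] Z.

(** Outside of [[-k, k]] the value is 0 instead of being clipped, so that a product of tilts
    vanishes as soon as one factor leaves the interval. *)
Definition tilt (k t z : R) : R := expR (t * z) * \1_`[- k, k] z.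

Definition trunc_mgf (k t : R) : R := fine (\int[P]_w (tilt k t (Z w))%:E).

Lemma tilt_ge0 k t z : 0 <= tilt k t z.
Proof. by rewrite mulr_ge0 ?expR_ge0// indicE ler0n. Qed.

Lemma tilt_in k t z : `|z| <= k -> tilt k t z = expR (t * z).
Proof. by move=> zk; rewrite /tilt indicE mem_set ?mulr1//= in_itv/= -ler_norml. Qed.

Lemma tilt_out k t z : k < `|z| -> tilt k t z = 0.
Proof.
by move=> zk; rewrite /tilt indicE memNset ?mulr0//= in_itv/= -ler_norml leNgt zk.
Qed.

Lemma tilt_le k t z : tilt k t z <= expR (t * z).
Proof.
by have [/tilt_in->|/tilt_out->] := leP `|z| k; rewrite ?lexx ?expR_ge0.
Qed.

Lemma measurable_tilt k t : measurable_fun [set: R] (tilt k t).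
Proof.
apply: measurable_funM; last exact: measurable_indic.
by apply: measurableT_comp => //; exact: measurable_funM.
Qed.

Let mtilt k t : measurable_fun [set: T] (fun w => (tilt k t (Z w))%:E).
Proof.
by apply/measurable_EFinP; apply: measurableT_comp mZ; exact: measurable_tilt.
Qed.

Let tilt0 k t w : (0 <= (tilt k t (Z w))%:E)%E.
Proof. by rewrite lee_fin tilt_ge0. Qed.

(** The integrand is at most [e^(|t| |k|)], so the integral is finite and [fine] loses nothing. *)
Lemma trunc_mgfE k t : (\int[P]_w (tilt k t (Z w))%:E = (trunc_mgf k t)%:E)%E.
Proof.
rewrite /trunc_mgf fineK// ge0_fin_numE; last exact: integral_ge0.
apply: (@le_lt_trans _ _ (\int[P]_w (cst (expR (`|t| * `|k|))%:E w))%E).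
  apply: ge0_le_integral => // w _ /=; rewrite lee_fin.
  have [zk|/tilt_out->] := leP `|Z w| k; last exact: expR_ge0.
  rewrite tilt_in// ler_expR (le_trans (ler_norm _))// normrM.
  by rewrite ler_wpM2l// (le_trans zk)// ler_norm.
by rewrite integral_cst//= probability_setT mule1 ltry.
Qed.

Lemma trunc_mgf_ge0 k t : 0 <= trunc_mgf k t.
Proof. by rewrite -lee_fin -trunc_mgfE integral_ge0. Qed.

Lemma trunc_mgf0_le1 k : trunc_mgf k 0 <= 1.
Proof.
rewrite -lee_fin -trunc_mgfE.
apply: (@le_trans _ _ (\int[P]_w (cst 1%:E w))%E); last first.
  by rewrite integral_cst//= probability_setT mule1.
apply: ge0_le_integral => // w _ /=; change ((tilt k 0 (Z w))%:E <= 1%:E)%E; rewrite lee_fin.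
by rewrite (le_trans (tilt_le _ _ _))// mul0r expR0.
Qed.

Lemma trunc_mgf_homo k l t : k <= l -> trunc_mgf k t <= trunc_mgf l t.
Proof.
move=> kl; rewrite -lee_fin -!trunc_mgfE; apply: ge0_le_integral => // w _.
rewrite lee_fin; have [zk|/tilt_out->] := leP `|Z w| k; last exact: tilt_ge0.
by rewrite !tilt_in// (le_trans zk).
Qed.

(** On [[-k, k]] the exponent changes by at most [|s - t| k]. Used in both directions, this yields
    continuity in [t]. *)
Lemma trunc_mgf_shift k s t :
  trunc_mgf k s <= expR (`|s - t| * k) * trunc_mgf k t.
Proof.
rewrite -lee_fin EFinM -!trunc_mgfE -ge0_integralZl//.
apply: ge0_le_integral => //; first exact: measurable_funeM.
move=> w _; rewrite -EFinM lee_fin.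
have [zk|zk] := leP `|Z w| k; last by rewrite !tilt_out// mulr0.
rewrite !tilt_in// -expRD ler_expR -lerBlDr -mulrBl.
by rewrite (le_trans (ler_norm _))// normrM ler_wpM2l.
Qed.

(** Pointwise this is [expR_second_difference_le] at [u = s z], where [|u| <= k] because
    [|s| <= 1]. *)
Lemma trunc_mgf_second_difference k t s : 0 <= k -> `|s| <= 1 ->
  trunc_mgf k (t + s) + trunc_mgf k (t - s) <=
  (2 + s ^+ 2 * (k ^+ 2 * expR k)) * trunc_mgf k t.
Proof.
move=> k0 s1; set C := (X in X * trunc_mgf k t).
have C0 : 0 <= C by rewrite addr_ge0// mulr_ge0 ?sqr_ge0// mulr_ge0 ?sqr_ge0 ?expR_ge0.
rewrite -lee_fin EFinM EFinD -!trunc_mgfE -ge0_integralZl// -ge0_integralD//.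
apply: ge0_le_integral => //; first by move=> w _; rewrite adde_ge0.
- exact: emeasurable_funD.
- exact: measurable_funeM.
move=> w _; rewrite -EFinM -EFinD lee_fin.
have [zk|zk] := leP `|Z w| k; last by rewrite !tilt_out// mulr0 addr0.
rewrite !tilt_in// mulrDl mulrBl !expRD -mulrDr mulrC ler_wpM2r ?expR_ge0//.
rewrite (le_trans (expR_second_difference_le _))// lerD2l exprMn -mulrA.
rewrite ler_wpM2l ?sqr_ge0// ler_pM ?sqr_ge0 ?expR_ge0//.
  by rewrite -[leLHS]real_normK ?num_real// ler_sqr ?nnegrE.
by rewrite ler_expR normrM -[leRHS]mul1r ler_pM.
Qed.

(** At a minimum neither neighbour is below [phi t], so the bound on their sum bounds each by
    [(1 + C s^2) phi t], and [1 + C s^2 < 1 + s delta <= e^(s delta)] once [C s < delta]. *)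
Lemma trunc_mgf_near_min k t delta : 0 <= k -> 0 < delta ->
    0 < trunc_mgf k t -> (forall s, trunc_mgf k t <= trunc_mgf k s) ->
  exists2 s, 0 < s &
    trunc_mgf k (t + s) * expR (- (s * delta)) < trunc_mgf k t /\
    trunc_mgf k (t - s) * expR (- (s * delta)) < trunc_mgf k t.
Proof.
move=> k0 delta0 phi0 phimin; pose C := k ^+ 2 * expR k.
have C0 : 0 <= C by rewrite mulr_ge0 ?sqr_ge0 ?expR_ge0.
have D0 : 0 < C + 1 + delta by lra.
(* Chosen to give both [s <= 1] and [s * C < delta]. *)
pose s := delta / (C + 1 + delta).
have s0 : 0 < s by rewrite divr_gt0.
have s1 : s <= 1 by rewrite ler_pdivrMr// mul1r; lra.
have sC : s * C < delta.
  by rewrite mulrAC ltr_pdivrMr// ltr_pM2l//; lra.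
exists s => //.
have h := @trunc_mgf_second_difference k t s k0.
have {}h : trunc_mgf k (t + s) + trunc_mgf k (t - s) <=
    (2 + s ^+ 2 * C) * trunc_mgf k t by apply: h; rewrite gtr0_norm.
have m1 := phimin (t + s); have m2 := phimin (t - s).
have fin x : x <= (1 + s ^+ 2 * C) * trunc_mgf k t ->
    x * expR (- (s * delta)) < trunc_mgf k t.
  move=> xle; rewrite expRN ltr_pdivrMr ?expR_gt0//.
  apply: (le_lt_trans xle); rewrite mulrC ltr_pM2l//.
  apply: (@lt_le_trans _ _ (1 + s * delta)); last exact: expR_ge1Dx.
  by rewrite ltrD2l expr2 -mulrA ltr_pM2l.
by split; apply: fin; lra.
Qed.

End truncated_mgf.

(** * Growing truncation levels and the existence of a global minimizer *)

Section truncated_mgf_limit.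
Context d (T : measurableType d) (R : realType) (P : probability T R).

(** The segments increase to the open half-line, and the measure is continuous from below. *)
Lemma near_probability_segment_gt0 (Z : T -> R) :
    measurable_fun [set: T] Z -> (0 < P (Z @^-1` `]0, +oo[)%R)%E ->
  \forall n \near \oo, (0 < P (Z @^-1` `[n.+1%:R^-1, n.+1%:R])%R)%E.
Proof.
move=> mZ; pose F n := Z @^-1` `[n.+1%:R^-1, n.+1%:R]; rewrite -/F.
have mF n : measurable (F n) by rewrite -[F n]setTI; exact: mZ.
have F_nd : {homo F : m n / (m <= n)%N >-> (m <= n)%O}.
  move=> m n mn; apply/subsetPset => w; rewrite /F /= !in_itv/= => /andP[Zm Zm'].
  rewrite (le_trans _ Zm)/= ?(le_trans Zm')// ?lef_pV2 ?posrE ?ltr0n//.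
    by rewrite ler_nat.
  by rewrite ler_nat.
have mUF : measurable (\bigcup_n F n) by exact: bigcup_measurable.
have -> : Z @^-1` `]0, +oo[ = \bigcup_n F n.
  apply/seteqP; split => w /=; last first.
    move=> [n _]; rewrite /F /= !in_itv/= andbT => /andP[h _].
    by rewrite (lt_le_trans _ h)// invr_gt0 ltr0n.
  rewrite in_itv/= andbT => Z0.
  exists (maxn (Num.truncn (Z w)) (Num.truncn (Z w)^-1)) => //.
  rewrite /F /= in_itv/=; apply/andP; split.
    rewrite -[leRHS]invrK lef_pV2 ?posrE ?invr_gt0// ltW//.
    apply: (lt_le_trans (truncnS_gt _)); rewrite ler_nat ltnS leq_max leqnn orbT//.
  by apply: ltW; apply: (lt_le_trans (truncnS_gt _)); rewrite ler_nat ltnS leq_maxl.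
by move=> P0; exact: (nondecreasing_cvg_mu mF mUF F_nd (open_ereal_gt' P0)).
Qed.

Variable Z : T -> R.
Hypothesis mZ : measurable_fun [set: T] Z.

Local Notation phi := (trunc_mgf P Z).

(** Pointwise, [e^c] times the indicator of [A] is below the tilt. On events where [Z] is bounded
    away from 0 this makes [phi] grow with [|t|]. *)
Lemma trunc_mgf_lower_bound k t c (A : set T) : measurable A ->
    (forall w, A w -> `|Z w| <= k /\ c <= t * Z w) ->
  expR c * fine (P A) <= phi k t.
Proof.
move=> mA AZ; rewrite -lee_fin EFinM fineK ?fin_num_measure// -trunc_mgfE//.
rewrite -[A in P A]setIT -integral_indic// -ge0_integralZl//; last first.
  by apply/measurable_EFinP; exact: measurable_indic.
apply: ge0_le_integral => //.
- by apply: measurable_funeM; apply/measurable_EFinP; exact: measurable_indic.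
- by apply/measurable_EFinP; apply: measurableT_comp mZ; exact: measurable_tilt.
move=> w _; rewrite -EFinM lee_fin indicE.
have [|] := boolP (w \in A); rewrite /= ?mulr0 ?tilt_ge0// inE => /AZ[Zk cZ].
by rewrite mulr1 tilt_in// ler_expR.
Qed.

Lemma continuous_trunc_mgf k : 0 <= k -> continuous (phi k).
Proof.
move=> k0 t; pose e (c : R) (s : R) := expR (c * `|s - t|) * phi k t.
have cvg_e c : e c s @[s --> t] --> phi k t.
  have h : continuous (e c).
    move=> s; apply: cvgM; last exact: cvg_cst.
    apply: continuous_comp; last exact: continuous_expR.
    apply: cvgM; first exact: cvg_cst.
    by apply: cvg_norm; apply: cvgB; [exact: cvg_id|exact: cvg_cst].
  by have := h t; rewrite /continuous_at {2}/e subrr normr0 mulr0 expR0 mul1r.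
apply: (squeeze_cvgr _ (cvg_e (- k)) (cvg_e k)); near=> s.
rewrite /e [k * _]mulrC trunc_mgf_shift// andbT mulNr expRN mulrC ler_pdivrMr ?expR_gt0//.
by rewrite mulrC [k * _]mulrC distrC trunc_mgf_shift.
Unshelve. all: by end_near. Qed.

(** Monotone convergence in the level. The full integral may be infinite, so it is a strict lower
    bound that is transferred to finite levels. *)
Lemma trunc_mgf_gt (alpha t : R) :
    (alpha%:E < \int[P]_w (expR (t * Z w))%:E)%E ->
  \forall n \near \oo, alpha < phi n%:R t.
Proof.
move=> lt_alpha; have : (phi n%:R t)%:E @[n --> \oo] --> (\int[P]_w (expR (t * Z w))%:E)%E.
  under eq_cvg do rewrite -trunc_mgfE//.
  have -> : (\int[P]_w (expR (t * Z w))%:E =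
      \int[P]_w limn (fun n => (tilt n%:R t (Z w))%:E))%E.
    apply: eq_integral => w _; apply/esym/cvg_lim => //; apply: cvg_near_cst.
    near=> n; rewrite tilt_in//; near: n; exact: nbhs_infty_ger.
  apply: cvg_monotone_convergence => //.
  - move=> n; apply/measurable_EFinP; apply: measurableT_comp mZ; exact: measurable_tilt.
  - by move=> n w _; rewrite lee_fin tilt_ge0.
  - move=> w _ m n mn; rewrite lee_fin.
    have [zk|/tilt_out->] := leP `|Z w| m%:R; last exact: tilt_ge0.
    by rewrite !tilt_in// (le_trans zk)// ler_nat.
move/(_ _ (open_ereal_gt' lt_alpha)) => h.
by near=> n; rewrite -lte_fin; near: n; exact: h.
Unshelve. all: by end_near. Qed.

(** Mass on both sides of 0 makes [phi k] coercive, uniformly in large [k]. On the remaining compact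
    range of [t] a single level exceeds [alpha], and the minimum over that range is global. *)
Lemma trunc_mgf_min (alpha : R) :
    (forall t, (alpha%:E < \int[P]_w (expR (t * Z w))%:E)%E) ->
    (0 < P (Z @^-1` `]0, +oo[)%R)%E -> (0 < P (Z @^-1` `]-oo, 0[)%R)%E ->
  exists k t, [/\ 0 <= k, alpha < phi k t & forall s, phi k t <= phi k s].
Proof.
move=> lt_alpha Zpos Zneg.
have [N [Pp Pn]] : exists N : nat, (0 < P (Z @^-1` `[N.+1%:R^-1, N.+1%:R])%R)%E /\
    (0 < P (Z @^-1` `[- N.+1%:R, - N.+1%:R^-1])%R)%E.
  have np := near_probability_segment_gt0 mZ Zpos.
  have mNZ : measurable_fun [set: T] (\- Z) by exact: measurable_funN.
  have {}Zneg : (0 < P ((\- Z) @^-1` `]0, +oo[)%R)%E.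
    rewrite (_ : _ @^-1` _ = Z @^-1` `]-oo, 0[)//.
    by apply/seteqP; split => w /=; rewrite !in_itv/= andbT oppr_gt0.
  have nn := near_probability_segment_gt0 mNZ Zneg.
  near \oo => N; exists N; split; first by near: N.
  rewrite (_ : _ @^-1` _ = (\- Z) @^-1` `[N.+1%:R^-1, N.+1%:R]); first by near: N.
  by apply/seteqP; split => w /=; rewrite !in_itv/= lerNl lerNr andbC.
pose eta : R := N.+1%:R^-1; pose K : R := N.+1%:R; rewrite -/eta -/K in Pp Pn.
have eta0 : 0 < eta by rewrite invr_gt0.
have K0 : 0 <= K by rewrite ler0n.
pose p := Num.min (fine (P (Z @^-1` `[eta, K])%R)) (fine (P (Z @^-1` `[- K, - eta])%R)).
have mpre A : measurable A -> measurable (Z @^-1` A).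
  by move=> mA; rewrite -[_ @^-1` _]setTI; exact: mZ.
have p0 : 0 < p.
  rewrite lt_min !fine_gt0//; apply/andP; split => //;
    by rewrite ltey_eq fin_num_measure//; exact: mpre.
have growth t : p * (1 + `|t| * eta) <= phi K t.
  apply: (@le_trans _ _ (expR (`|t| * eta) * p)).
    by rewrite mulrC ler_wpM2r ?(ltW p0)// expR_ge1Dx.
  have [t0|t0] := leP 0 t.
    apply: le_trans (@trunc_mgf_lower_bound K t (t * eta) _
      (mpre _ (measurable_itv `[eta, K])) _).
      by rewrite ger0_norm// ler_wpM2l ?expR_ge0// ge_min lexx.
    move=> w /=; rewrite in_itv/= => /andP[eZ ZK]; split; last by rewrite ler_wpM2l.
    by rewrite ger0_norm// (le_trans (ltW eta0)).
  apply: le_trans (@trunc_mgf_lower_bound K t (- t * eta) _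
    (mpre _ (measurable_itv `[- K, - eta])) _).
    by rewrite ltr0_norm// ler_wpM2l ?expR_ge0// ge_min lexx orbT.
  move=> w /=; rewrite in_itv/= => /andP[eZ ZK]; split.
    by rewrite ler_norml eZ (le_trans ZK)// (le_trans _ K0)// oppr_le0 ltW.
  by rewrite mulNr -mulrN ler_wnM2l// ltW.
(* Beyond [B] the linear growth gives [phi >= |t| p eta >= 1], while [phi] is at most 1 at 0. *)
pose B := (p * eta)^-1.
have B0 : 0 <= B by rewrite invr_ge0 mulr_ge0 ?ltW.
have outside t n : K <= n%:R -> B < `|t| -> 1 <= phi n%:R t.
  move=> Kn Bt; apply: le_trans (trunc_mgf_homo P mZ t Kn); apply: le_trans (growth t).
  rewrite mulrDr mulr1 mulrCA; apply: (@le_trans _ _ (`|t| * (p * eta))).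
    by rewrite -ler_pdivrMr ?mulr_gt0// mul1r ltW.
  by rewrite lerDr ltW.
have [n Kn nalpha] : exists2 n : nat, K <= n%:R &
    `[- B, B] `<=` [set t | alpha < phi n%:R t].
  suff H : \forall n \near \oo, `[- B, B] `<=` [set t | alpha < phi n%:R t].
    near \oo => n; exists n; first by near: n; exact: nbhs_infty_ger.
    by near: n.
  (* Compactness in filter form: a level [m] with [alpha < phi m t] serves all points near [t] by
     continuity, and all larger levels by monotonicity. *)
  have /compact_near_coveringP := @segment_compact R (- B) B.
  apply => t _.
  have [m _ mt] := trunc_mgf_gt (lt_alpha t).
  have mt' := mt m (leqnn m).
  have := cvgr_gt _ (@continuous_trunc_mgf m%:R (ler0n _ _) t) alpha mt'.
  move=> tn; near=> s n => /=.
  apply: (@lt_le_trans _ _ (phi m%:R s)); first by near: s; exact: tn.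
  apply: trunc_mgf_homo => //; rewrite ler_nat; near: n; exact: nbhs_infty_ge.
have BB : - B <= B by lra.
have [t0 tB tmin] := EVT_min BB (continuous_subspaceT (continuous_trunc_mgf (ler0n R n))).
exists n%:R, t0; split => //; first by exact: nalpha.
move=> s; have [sB|sB] := leP `|s| B; first by apply: tmin; rewrite in_itv/= -ler_norml.
apply: le_trans (outside _ _ Kn sB); apply: le_trans (trunc_mgf0_le1 P mZ n%:R).
by apply: tmin; rewrite in_itv/= oppr_le0 B0.
Unshelve. all: by end_near. Qed.

End truncated_mgf_limit.

(** * Lower bound and Chernoff bound for sums of i.i.d. variables *)

Section iid_lower_bound.
Context d (T : measurableType d) (R : realType) (P : probability T R).
Variable X : nat -> {RV P >-> R}.
Hypothesis iidX : iid X.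

Definition iid_sum (h : R -> R) (n : nat) (w : T) : R := \sum_(i < n) h (X i w).

Lemma measurable_iid_sum h n : measurable_fun [set: R] h ->
  measurable_fun [set: T] (iid_sum h n).
Proof.
by move=> mh; apply: measurable_sum => i; apply: measurableT_comp mh _.
Qed.

Lemma measurable_iid_sum_ball h n c : measurable_fun [set: R] h ->
  measurable [set w | `|iid_sum h n w| < c].
Proof.
move=> mh; rewrite (_ : [set _ | _] = iid_sum h n @^-1` `]- c, c[).
  by rewrite -[_ @^-1` _]setTI; exact: measurable_iid_sum.
by apply/seteqP; split => w /=; rewrite in_itv/= ltr_norml.
Qed.

Lemma prod_tilt h k t n w : (forall i : 'I_n, `|h (X i w)| <= k) ->
  \prod_(i < n) tilt k t (h (X i w)) = expR (t * iid_sum h n w).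
Proof.
move=> hk; rewrite /iid_sum mulr_sumr expR_sum.
by apply: eq_bigr => i _; rewrite tilt_in.
Qed.

Section measurable_observable.
Variable h : R -> R.
Hypothesis mh : measurable_fun [set: R] h.

Let Z w := h (X 0%N w).
Let mZ : measurable_fun [set: T] Z.
Proof. exact: measurableT_comp. Qed.

Local Notation phi := (trunc_mgf P Z).

Lemma iid_integral_prod_tilt k t n :
  (\int[P]_w (\prod_(i < n) tilt k t (h (X i w)))%:E = (phi k t ^+ n)%:E)%E.
Proof.
apply: (iid_integral_prod iidX n (f := tilt k t \o h)).
- by apply: measurableT_comp mh; exact: measurable_tilt.
- by move=> x; exact: tilt_ge0.
- exact: (trunc_mgfE P mZ).
Qed.

(* Exponential change of measure carried out on the integrand: the tilted mass
   outside of the ball is dominated by that of the tilts at [t + s], [t - s]. *)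
Lemma trunc_mgf_exprn_le k t s delta n : 0 <= s ->
  phi k t ^+ n <=
    expR (n%:R * (delta * `|t|)) *
      fine (P [set w | `|iid_sum h n w| < n%:R * delta]) +
    (phi k (t + s) * expR (- (s * delta))) ^+ n +
    (phi k (t - s) * expR (- (s * delta))) ^+ n.
Proof.
move=> s0; pose A := [set w | `|iid_sum h n w| < n%:R * delta].
have mA : measurable A by exact: measurable_iid_sum_ball.
pose F t w := \prod_(i < n) tilt k t (h (X i w)).
have F0 t' w : 0 <= F t' w by apply: prodr_ge0 => i _; exact: tilt_ge0.
have F0E t' w : (0 <= (F t' w)%:E)%E by rewrite lee_fin.
have mF t' : measurable_fun [set: T] (fun w => (F t' w)%:E).
  apply/measurable_EFinP; apply: measurable_prod => i _.
  apply: measurableT_comp; first exact: measurable_tilt.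
  exact: measurableT_comp.
have mA' : measurable_fun [set: T] (fun w => (\1_A w : R)%:E).
  by apply/measurable_EFinP; exact: measurable_indic.
pose a := expR (n%:R * (delta * `|t|)); pose b := expR (- (s * delta)) ^+ n.
have b0 : 0 <= b by rewrite exprn_ge0 ?expR_ge0.
have a0 : 0 <= a by exact: expR_ge0.
have A0 w : 0 <= \1_A w :> R by rewrite indicE ler0n.
have mbF t' : measurable_fun [set: T] (fun w => b%:E * (F t' w)%:E)%E.
  exact: measurable_funeM.
have maA : measurable_fun [set: T] (fun w => a%:E * (\1_A w : R)%:E)%E.
  exact: measurable_funeM.
have intF t' : (\int[P]_w (F t' w)%:E = (phi k t' ^+ n)%:E)%E.
  exact: iid_integral_prod_tilt.
rewrite !exprMn -/a -/b -/A -lee_fin !EFinD !EFinM fineK ?fin_num_measure//.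
rewrite -[A in P A]setIT -integral_indic// -!intF.
rewrite ![(_ * b%:E)%E]muleC -!ge0_integralZl//.
have bFE t' w : (0 <= b%:E * (F t' w)%:E)%E by rewrite mule_ge0.
have aAE w : (0 <= a%:E * (\1_A w : R)%:E)%E by rewrite mule_ge0 ?lee_fin.
rewrite -!ge0_integralD//; last 2 first.
- by move=> w _; rewrite adde_ge0.
- exact: emeasurable_funD.
apply: ge0_le_integral => //.
- by apply: emeasurable_funD => //; exact: emeasurable_funD.
move=> w _; rewrite -!EFinM -!EFinD lee_fin.
have aA : 0 <= a * \1_A w by rewrite mulr_ge0.
have bF t' : 0 <= b * F t' w by rewrite mulr_ge0.
(* If some factor is truncated the left side is 0; otherwise each product of tilts is an exponential
   of the sum. *)
have [hk|] := pselect (forall i : 'I_n, `|h (X i w)| <= k); last first.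
  move/existsNP => [i /negP]; rewrite -ltNge => hi.
  by rewrite {1}/F (bigD1 i)//= tilt_out// mul0r !addr_ge0.
have FE t' : F t' w = expR (t' * iid_sum h n w) by exact: prod_tilt.
have [wA|] := boolP (w \in A).
  rewrite indicE wA mulr1 -addrA ler_wpDr ?addr_ge0// FE ler_expR.
  move: wA; rewrite inE /A/= => wA.
  rewrite mulrA [leRHS]mulrC (le_trans (ler_norm _))// normrM.
  by rewrite ler_wpM2l// ltW.
(* Outside of the ball the sum is at least [n delta] or at most [- n delta]; accordingly the tilt at
   [t + s] or at [t - s] gains at least [e^(s n delta)] over the tilt at [t]. *)
rewrite notin_setE /A/= => /negP; rewrite -leNgt ler_normr => wA.
have bE : b = expR (- (s * (n%:R * delta))).
  by rewrite /b -expRM_natl mulrN mulrCA.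
rewrite -addrA (le_trans _ (ler_wpDl aA (lexx _)))// !FE bE.
have [wS|wS] := orP wA.
  rewrite ler_wpDr ?mulr_ge0 ?expR_ge0// -expRD ler_expR mulrDl.
  by rewrite addrC -addrA lerDl -mulrBr mulr_ge0// subr_ge0.
rewrite ler_wpDl ?mulr_ge0 ?expR_ge0// -expRD ler_expR mulrBl.
by rewrite addrC -addrA lerDl -opprD -mulrDr oppr_ge0 mulr_ge0_le0//; lra.
Qed.

Lemma near_iid_sum_ball_nondegenerate (alpha delta : R) : 0 < alpha -> 0 < delta ->
    (forall t, (alpha%:E < \int[P]_w (expR (t * Z w))%:E)%E) ->
    (0 < P (Z @^-1` `]0, +oo[)%R)%E -> (0 < P (Z @^-1` `]-oo, 0[)%R)%E ->
  \forall n \near \oo,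
    ((alpha ^+ n)%:E <= P [set w | (`|iid_sum h n w| < n%:R * delta)%R])%E.
Proof.
move=> alpha0 delta0 lt_alpha Zpos Zneg.
have [k [t [k0 alphaphi phimin]]] := trunc_mgf_min mZ lt_alpha Zpos Zneg.
have phi0 : 0 < phi k t by exact: lt_trans alphaphi.
pose L := ln (phi k t / alpha).
have L0 : 0 < L by rewrite ln_gt0// ltr_pdivlMr// mul1r.
have t1 : 0 < `|t| + 1 by rewrite ltr_wpDl.
(* The ball is shrunk to a radius [e] for which the cost [e^(e |t|)] of the tilt fits into the gap
   between [alpha] and [phi k t]. *)
pose e := Num.min delta (L / (`|t| + 1)).
have e0 : 0 < e by rewrite lt_min delta0 divr_gt0.
have eL : e * `|t| < L.
  apply: (@le_lt_trans _ _ (L / (`|t| + 1) * `|t|)).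
    by rewrite ler_wpM2r// ge_min lexx orbT.
  by rewrite mulrAC ltr_pdivrMr// ltr_pM2l// ltrDl.
pose a := alpha * expR (e * `|t|).
have a_phi : 0 <= a < phi k t.
  rewrite mulr_ge0 ?expR_ge0 ?(ltW alpha0)//= /a mulrC -ltr_pdivlMr//.
  by rewrite -[ltRHS]lnK ?posrE ?divr_gt0// ltr_expR.
have [s s0 [hp hn]] := trunc_mgf_near_min mZ k0 e0 phi0 phimin.
set bp := _ * _ in hp; set bn := _ * _ in hn.
have bp0 : 0 <= bp by rewrite mulr_ge0 ?expR_ge0 ?trunc_mgf_ge0.
have bn0 : 0 <= bn by rewrite mulr_ge0 ?expR_ge0 ?trunc_mgf_ge0.
have b_phi : 0 <= Num.max bp bn < phi k t by rewrite le_max bp0 gt_max hp hn.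
have near_le := near_exprn_lt a_phi b_phi (ler0n R 2).
near=> n.
have mA c : measurable [set w | `|iid_sum h n w| < n%:R * c].
  exact: measurable_iid_sum_ball.
have : a ^+ n + 2 * Num.max bp bn ^+ n <= phi k t ^+ n by near: n; exact: near_le.
move/le_trans/(_ (trunc_mgf_exprn_le k t e n (ltW s0))).
rewrite -/bp -/bn => le1.
have bpn : bp ^+ n <= Num.max bp bn ^+ n by rewrite lerXn2r ?nnegrE ?le_max ?lexx ?bp0.
have bnn : bn ^+ n <= Num.max bp bn ^+ n.
  by rewrite lerXn2r ?nnegrE ?le_max ?lexx ?bp0 ?orbT.
have {le1} : a ^+ n <= expR (n%:R * (e * `|t|)) *
    fine (P [set w | `|iid_sum h n w| < n%:R * e]) by lra.
rewrite expRM_natl /a exprMn mulrC ler_pM2l ?exprn_gt0 ?expR_gt0//.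
rewrite -lee_fin fineK ?fin_num_measure// => /le_trans; apply.
apply: le_measure; rewrite ?inE// => w /= /lt_le_trans; apply.
by rewrite ler_wpM2l// ge_min lexx.
Unshelve. all: by end_near. Qed.

(** Since [Z >= 0] almost surely, the expectation at [t = - s] is at most
    [P (|Z| < delta) + e^(- s delta)]. Large [s] leaves [alpha <= P (|Z| < delta)], and independence
    gives the power. *)
Lemma near_iid_sum_ball_degenerate (alpha delta : R) : 0 < alpha -> 0 < delta ->
    (forall t, (alpha%:E < \int[P]_w (expR (t * Z w))%:E)%E) ->
    P (Z @^-1` `]-oo, 0[)%R = 0%E ->
  \forall n \near \oo,
    ((alpha ^+ n)%:E <= P [set w | (`|iid_sum h n w| < n%:R * delta)%R])%E.
Proof.
move=> alpha0 delta0 lt_alpha Z0.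
have mpre A : measurable A -> measurable (Z @^-1` A).
  by move=> mA; rewrite -[_ @^-1` _]setTI; exact: mZ.
pose A := Z @^-1` `]- delta, delta[.
have mA : measurable A by exact: mpre.
have alphaA s : 0 <= s -> alpha <= fine (P A) + expR (- (s * delta)).
  move=> s0; rewrite -lee_fin; apply: le_trans (ltW (lt_alpha (- s))) _.
  rewrite EFinD fineK ?fin_num_measure//.
  rewrite -[A in P A]setIT -integral_indic//.
  have -> : (expR (- (s * delta)))%:E =
      (\int[P]_w (cst (expR (- (s * delta)))%:E w))%E.
    by rewrite integral_cst//= probability_setT mule1.
  have mE : measurable_fun [set: T] (fun w => (\1_A w : R)%:E).
    by apply/measurable_EFinP; exact: measurable_indic.
  have E0 w : (0 <= (\1_A w : R)%:E)%E by rewrite lee_fin indicE ler0n.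
  have c0 w : (0 <= cst (expR (- (s * delta)))%:E w :> \bar R)%E.
    by rewrite lee_fin expR_ge0.
  rewrite -ge0_integralD//; apply: ae_ge0_le_integral => //.
  - apply/measurable_EFinP; apply: measurableT_comp => //.
    exact: measurable_funM.
  - by move=> w _; rewrite adde_ge0.
  - exact: emeasurable_funD.
  (* The pointwise bound can fail only on the null set where [Z < 0]. *)
  exists (Z @^-1` `]-oo, 0[); split => //; first exact: mpre.
  move=> w /= /not_implyP[_ +]; rewrite in_itv/= -EFinD lee_fin => H.
  rewrite ltNge; apply/negP => Zw0; apply: H.
  have [Zd|Zd] := ltP (Z w) delta.
    rewrite indicE mem_set/=; last first.
      by rewrite /A/= in_itv/= Zd andbT (lt_le_trans _ Zw0)// oppr_lt0.
    rewrite (@le_trans _ _ 1)// ?lerDl ?expR_ge0//.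
    by rewrite expR_le1 mulNr oppr_le0 mulr_ge0.
  by rewrite ler_wpDl ?indicE ?ler0n// ler_expR mulNr lerN2 ler_wpM2l.
have alpha_le : alpha <= fine (P A).
  rewrite leNgt; apply/negP => lt_A; pose e := alpha - fine (P A).
  have e0 : 0 < e by rewrite subr_gt0.
  (* With this value as [s] the bound reads [e <= expR (- e^-1)], against
     [expR e^-1 >= 1 + e^-1]. *)
  have s0 : 0 <= (e * delta)^-1 by rewrite invr_ge0 mulr_ge0 ?ltW.
  have := alphaA _ s0; rewrite -lerBlDl -/e invfM -mulrA mulVf ?gt_eqF// mulr1.
  rewrite expRN leNgt => /negP; apply.
  rewrite -[ltRHS]invrK ltf_pV2 ?posrE ?expR_gt0 ?invr_gt0//.
  by apply: lt_le_trans (expR_ge1Dx _); rewrite ltrDr.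
near=> n.
(* For [n = 0] the open ball is empty. *)
have n0 : (0 < n)%N by near: n; exact: nbhs_infty_gt.
have mh' : measurable (h @^-1` `]- delta, delta[).
  by rewrite -[_ @^-1` _]setTI; exact: mh.
apply: (@le_trans _ _
    (P (\bigcap_(i in [set: 'I_n]) (X i @^-1` (h @^-1` `]- delta, delta[))))).
  have -> := @iid_probability_bigcap _ _ _ _ _ iidX n
    (fun=> h @^-1` `]- delta, delta[) (fun=> mh').
  rewrite -(fineK (fin_num_measure P _ mA)) prodEFin prodr_const card_ord lee_fin.
  by rewrite lerXn2r ?nnegrE ?(ltW alpha0)// fine_ge0.
apply: le_measure; rewrite ?inE.
- apply: fin_bigcap_measurable => // i _.
  by rewrite -[_ @^-1` _]setTI; exact: measurable_funPT.
- exact: measurable_iid_sum_ball.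
move=> w H /=; apply: le_lt_trans (ler_norm_sum _ _ _) _.
rewrite mulr_natl -[X in _ *+ X]card_ord -sumr_const; apply: ltr_sum.
  by apply/hasP; exists (Ordinal n0) => //; rewrite mem_index_enum.
by move=> i _; have := H i I; rewrite /= in_itv/= ltr_norml.
Unshelve. all: by end_near. Qed.

End measurable_observable.

Lemma near_iid_sum_ball (h : R -> R) (alpha delta : R) : measurable_fun [set: R] h ->
    0 < alpha -> 0 < delta ->
    (forall t : R, (alpha%:E < \int[P]_w (expR (t * h (X 0%N w)))%:E)%E) ->
  \forall n \near \oo,
    ((alpha ^+ n)%:E <= P [set w | (`|iid_sum h n w| < n%:R * delta)%R])%E.
Proof.
move=> mh alpha0 delta0 lt_alpha; pose Z w := h (X 0%N w).
have [Zneg|] := eqVneq (P (Z @^-1` `]-oo, 0[)%R) 0%E.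
  exact: near_iid_sum_ball_degenerate.
rewrite -measure_gt0 => Zneg.
have [Zpos|] := eqVneq (P (Z @^-1` `]0, +oo[)%R) 0%E; last first.
  by rewrite -measure_gt0 => Zpos; exact: near_iid_sum_ball_nondegenerate.
(* Now [Z <= 0] almost surely; passing to [- h] reflects [t] and leaves the ball unchanged. *)
have mNh : measurable_fun [set: R] (\- h) by exact: measurable_funN.
have near_le : \forall n \near \oo,
    ((alpha ^+ n)%:E <= P [set w | (`|iid_sum (\- h) n w| < n%:R * delta)%R])%E.
  apply: near_iid_sum_ball_degenerate => // [t|].
    by have := lt_alpha (- t); under eq_integral do rewrite mulNr -mulrN.
  rewrite -Zpos; congr (P _); apply/seteqP.
  by split => w /=; rewrite !in_itv/= oppr_lt0 andbT.
near=> n; rewrite (_ : [set w | _] =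
    [set w | `|iid_sum (\- h) n w| < n%:R * delta]); first by near: n; exact: near_le.
by apply/seteqP; split => w /=; rewrite /iid_sum sumrN normrN.
Unshelve. all: by end_near. Qed.

(** The indicator of [0 <= S] is at most [e^S], a product over the sample. The tilt parameter and
    the centering are absorbed into [h]. *)
Lemma iid_chernoff (h : R -> R) (c : R) n : measurable_fun [set: R] h ->
    (\int[P]_w (expR (h (X 0%N w)))%:E = c%:E)%E ->
  (P [set w | (0 <= iid_sum h n w)%R] <= (c ^+ n)%:E)%E.
Proof.
move=> mh hc.
have mE : measurable_fun [set: R] (expR \o h) by exact: measurableT_comp.
have E0 x : 0 <= (expR \o h) x by exact: expR_ge0.
rewrite -(iid_integral_prod iidX n mE E0 hc).
pose A := [set w | 0 <= iid_sum h n w]; rewrite -/A.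
have mA : measurable A.
  rewrite (_ : A = iid_sum h n @^-1` `[0, +oo[).
    by rewrite -[_ @^-1` _]setTI; exact: measurable_iid_sum.
  by apply/seteqP; split => w /=; rewrite in_itv/= andbT.
rewrite -[A in P A]setIT -integral_indic//; apply: ge0_le_integral => //.
- by apply/measurable_EFinP; exact: measurable_indic.
- apply/measurable_EFinP; apply: measurable_prod => i _; exact: measurableT_comp.
move=> w _; rewrite lee_fin -expR_sum -/(iid_sum h n w) indicE.
have [|] := boolP (w \in A); rewrite /= ?expR_ge0// inE /A/= => S0.
by rewrite (le_trans _ (expR_ge1Dx _))// lerDl.
Qed.

End iid_lower_bound.

(** * The Legendre transform of the log-moment generating function *)

Section log_mgf_legendre.
Context d (T : measurableType d) (R : realType) (P : probability T R).
Variable Y : T -> R.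
Hypothesis mY : measurable_fun [set: T] Y.

Let measurable_expRM t : measurable_fun [set: T] (fun w => (expR (t * Y w))%:E).
Proof.
by apply/measurable_EFinP; apply: measurableT_comp => //; exact: measurable_funM.
Qed.

Let expRM_ge0 t w : (0 <= (expR (t * Y w))%:E)%E.
Proof. by rewrite lee_fin expR_ge0. Qed.

Lemma mgfE t : 'M_P Y t = (\int[P]_w (expR (t * Y w))%:E)%E.
Proof.
by rewrite /mmt_gen_fun unlock; apply: eq_integral => w _ /=; rewrite mulrC.
Qed.

Lemma mgf_ge0 t : (0 <= 'M_P Y t)%E.
Proof. by rewrite mgfE integral_ge0. Qed.

Lemma mgf0 : 'M_P Y 0 = 1%E.
Proof.
rewrite mgfE (_ : (fun _ => _) = cst 1%E) ?integral_cst//= ?mul1e ?probability_setT//.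
by apply/funext => w; rewrite mul0r expR0.
Qed.

Lemma integral_expR_shift t v :
  (\int[P]_w (expR (t * (Y w - v)))%:E = (expR (- (t * v)))%:E * 'M_P Y t)%E.
Proof.
rewrite mgfE -ge0_integralZl ?lee_fin ?expR_ge0//.
by apply: eq_integral => w _; rewrite -EFinM -expRD mulrBr addrC.
Qed.

Lemma log_mgf_gt (l t : R) :
  (l%:E < log_mgf P Y t)%E = ((expR l)%:E < 'M_P Y t)%E.
Proof.
rewrite /log_mgf; have := mgf_ge0 t; case: ('M_P Y t) => [m| |]//=.
  rewrite lee_fin => m0; case: ifPn => [m0'|].
- by rewrite ltNge leNye lte_fin; apply/esym/negbTE; rewrite -leNgt (le_trans m0')// expR_ge0.
- by rewrite -ltNge => {}m0; rewrite !lte_fin -ltr_expR lnK.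
- by rewrite !ltry.
Qed.

Lemma log_mgf_lt (l t : R) :
  (log_mgf P Y t < l%:E)%E = ('M_P Y t < (expR l)%:E)%E.
Proof.
rewrite /log_mgf; have := mgf_ge0 t; case: ('M_P Y t) => [m| |]//=.
rewrite lee_fin => m0; case: ifPn => [m0'|].
  by rewrite ltNyr lte_fin (le_lt_trans m0')// expR_gt0.
by rewrite -ltNge => {}m0; rewrite !lte_fin -[RHS]ltr_ln ?posrE ?expR_gt0// expRK.
Qed.

(** Exponentiation turns the term at [t] into the mean of [e^(t (Y - v))]. This form stays valid for
    an infinite generating function and is the one that the estimates for sums use. *)
Lemma legendre_term_lt (c t v : R) :
  ((v * t)%:E - log_mgf P Y t < c%:E)%E =
  ((expR (- c))%:E < \int[P]_w (expR (t * (Y w - v)))%:E)%E.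
Proof.
rewrite integral_expR_shift lte_subel_addl// -lteBlDr// -EFinB log_mgf_gt.
by rewrite [expR (- (t * v))]expRN lte_pdivlMl ?expR_gt0// -EFinM -expRD mulrC.
Qed.

Lemma legendre_term_gt (c t v : R) :
  (c%:E < (v * t)%:E - log_mgf P Y t)%E =
  (\int[P]_w (expR (t * (Y w - v)))%:E < (expR (- c))%:E)%E.
Proof.
transitivity (log_mgf P Y t < (v * t - c)%:E)%E.
  case: (log_mgf P Y t) => [l| |] //=; last by rewrite ltry ltNyr.
  by rewrite -EFinB !lte_fin; apply/idP/idP; lra.
rewrite integral_expR_shift log_mgf_lt [expR (- (t * v))]expRN.
by rewrite lte_pdivrMl ?expR_gt0// -EFinM -expRD mulrC.
Qed.

Lemma legendre_ge x t :
  ((x * t)%:E - log_mgf P Y t <= legendre (log_mgf P Y) x)%E.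
Proof. by apply: ereal_sup_ubound; exists t. Qed.

Lemma legendre_log_mgf_ge0 x : (0 <= legendre (log_mgf P Y) x)%E.
Proof.
by have := legendre_ge x 0; rewrite /log_mgf mgf0 lne1 mulr0 sube0.
Qed.
Lemma integrable_expRM_shift t v : (log_mgf P Y t < +oo)%E ->
  P.-integrable [set: T] (EFin \o (fun w => expR (t * (Y w - v)))).
Proof.
move=> Lt; apply/integrableP; split.
  apply/measurable_EFinP; apply: measurableT_comp => //; apply: measurable_funM => //.
  exact: measurable_funB.
under eq_integral do rewrite /= ger0_norm ?expR_ge0//.
rewrite integral_expR_shift; move: Lt; rewrite /log_mgf; have := mgf_ge0 t.
by case: ('M_P Y t) => [m| |] //= _ _; rewrite -EFinM ltry.
Qed.

Lemma integrable_expRM t : (log_mgf P Y t < +oo)%E ->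
  P.-integrable [set: T] (EFin \o (fun w => expR (t * Y w))).
Proof.
move=> /(@integrable_expRM_shift _ 0).
by under [X in EFin \o X]eq_fun do rewrite subr0.
Qed.

Section finite_near_zero.
Variable r : R.
Hypothesis r0 : 0 < r.
Hypothesis Lr : forall t, `|t| < r -> (log_mgf P Y t < +oo)%E.

(** With [0 < q < r], [q |Y| <= e^(q Y) + e^(- q Y)], and both exponentials are integrable. *)
Lemma integrable_log_mgf : P.-integrable [set: T] (EFin \o Y).
Proof.
pose q := r / 2.
have q0 : 0 < q by rewrite divr_gt0.
have qr : `|q| < r by rewrite gtr0_norm// ltr_pdivrMr// ltr_pMr// ltr1n.
have Lq t : `|t| = `|q| -> P.-integrable [set: T] (EFin \o (fun w => expR (t * Y w))).
  by move=> tq; apply: integrable_expRM; apply: Lr; rewrite tq.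
have intG : P.-integrable [set: T]
    (EFin \o (fun w => q^-1 * (expR (q * Y w) + expR (- q * Y w)))).
  exact: (integrableZl measurableT q^-1
    (integrableD measurableT (Lq q erefl) (Lq (- q) (normrN q)))).
apply: le_integrable intG => //; first exact/measurable_EFinP.
move=> w _ /=; rewrite lee_fin [leRHS]ger0_norm; last first.
  by rewrite mulr_ge0 ?addr_ge0 ?expR_ge0 ?invr_ge0 ?(ltW q0).
rewrite -ler_pdivrMl ?invr_gt0// invrK -[X in X * _]gtr0_norm// -normrM mulNr.
have : `|q * Y w| <= expR `|q * Y w| by rewrite (le_trans _ (expR_ge1Dx _))// lerDr.
move/le_trans; apply; have [z0|z0] := leP 0 (q * Y w).
  by rewrite ger0_norm// lerDl expR_ge0.
by rewrite ltr0_norm// lerDr expR_ge0.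
Qed.

Local Notation mu := (\int[P]_w Y w).

Let intYv v : P.-integrable [set: T] (EFin \o (fun w => Y w - v)).
Proof.
exact: (integrableB measurableT integrable_log_mgf
  (finite_measure_integrable_cst P v measurableT)).
Qed.

Let Rintegral_shift v : \int[P]_w (Y w - v) = mu - v.
Proof.
rewrite RintegralB//; first by rewrite Rintegral_cst//= probability_setT mulr1.
- exact: integrable_log_mgf.
- exact: finite_measure_integrable_cst.
Qed.

(** Jensen's inequality through the tangent line: [e^(t (Y - mu)) >= 1 + t (Y - mu)], whose right
    side has mean 1. *)
Lemma legendre_mean_le0 : (legendre (log_mgf P Y) mu <= 0)%E.
Proof.
apply: ge_ereal_sup => _ [t _ <-].
rewrite leNgt legendre_term_gt oppr0 expR0 -leNgt.
have [Lt|] := ltP (log_mgf P Y t) +oo%E; last first.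
  rewrite leye_eq integral_expR_shift => /eqP.
  rewrite /log_mgf; case: ('M_P Y t) => [m| |]//=; first by case: ifP.
  by rewrite gt0_muley ?lte_fin ?expR_gt0// leey.
have int := integrable_expRM_shift mu Lt.
rewrite -(fineK (integrable_fin_num measurableT int)) lee_fin.
change (1 <= \int[P]_w expR (t * (Y w - mu))).
apply: (@le_trans _ _ (\int[P]_w (1 + t * (Y w - mu)))).
  rewrite RintegralD//; last 2 first.
  - exact: finite_measure_integrable_cst.
  - exact: (integrableZl measurableT t (intYv mu)).
  rewrite RintegralZl// Rintegral_shift subrr mulr0 addr0 Rintegral_cst//=.
  by rewrite probability_setT mulr1.
apply: le_Rintegral => //.
- exact: (integrableD measurableT (finite_measure_integrable_cst P 1 measurableT)
    (integrableZl measurableT t (intYv mu))).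
- by move=> w _; exact: expR_ge1Dx.
Qed.

Lemma legendre_mean : legendre (log_mgf P Y) mu = 0%E.
Proof.
by apply/eqP; rewrite eq_le legendre_mean_le0 legendre_log_mgf_ge0.
Qed.

(** For small [t] the mean of [e^(t (Y - v))] is at most [1 + t (mu - v) + C t^2]. This is below 1
    for a suitable [t] of sign opposite to [mu - v], and the term at that [t] is positive. *)
Lemma legendre_gt0 v : v != mu -> (0 < legendre (log_mgf P Y) v)%E.
Proof.
(* One [q] pays for [z^2], another for [e^(|t z|)], and [2 q] is still below [r]. *)
move=> vmu; pose q := r / 3.
have q0 : 0 < q by rewrite divr_gt0.
have Lq t : `|t| < r -> P.-integrable [set: T] (EFin \o (fun w => expR (t * (Y w - v)))).
  by move=> tr; apply: integrable_expRM_shift; exact: Lr.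
have qr3 : r = 3 * q by rewrite /q mulrC divfK// pnatr_eq0.
have q2r : `|2 * q| < r.
  by rewrite gtr0_norm ?mulr_gt0// qr3; lra.
have q2r' : `|- (2 * q)| < r by rewrite normrN.
pose G w := expR (2 * q * (Y w - v)) + expR (- (2 * q) * (Y w - v)).
have intG : P.-integrable [set: T] (EFin \o G).
  exact: (integrableD measurableT (Lq _ q2r) (Lq _ q2r')).
(* The constant [D] comes from [(q z)^2 / 2 <= e^(q |z|)]. *)
pose D := 2 / q ^+ 2; pose C := D * \int[P]_w G w.
have D0 : 0 <= D by rewrite divr_ge0 ?sqr_ge0.
have C0 : 0 <= C.
  by rewrite mulr_ge0// Rintegral_ge0// => w _; rewrite addr_ge0 ?expR_ge0.
have dom t w : `|t| <= q ->
    expR (t * (Y w - v)) <= 1 + t * (Y w - v) + t ^+ 2 * D * G w.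
  move=> tq; set z := Y w - v.
  apply: le_trans (expR_le_quadratic _) _; rewrite lerD2l exprMn.
  rewrite -[leLHS]mulrA -[leRHS]mulrA ler_wpM2l ?sqr_ge0//.
  have z2 : z ^+ 2 <= D * expR (q * `|z|).
    rewrite /D mulrAC ler_pdivlMr ?exprn_gt0//.
    have := @expR_ge1Dxn R (q * `|z|) 1 (mulr_ge0 (ltW q0) (normr_ge0 z)).
    rewrite exprMn real_normK ?num_real// => h.
    have : (q ^+ 2 * z ^+ 2) / 2 <= expR (q * `|z|).
      by apply: le_trans h; rewrite lerDr.
    by rewrite ler_pdivrMr// mulrC [leRHS]mulrC.
  apply: (@le_trans _ _ (D * expR (q * `|z|) * expR (q * `|z|))).
    by rewrite ler_pM ?sqr_ge0 ?expR_ge0// ler_expR normrM ler_wpM2r.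
  rewrite -[leLHS]mulrA ler_wpM2l// -expRD /G -/z.
  have -> : q * `|z| + q * `|z| = 2 * q * `|z| by ring.
  have [z0|z0] := leP 0 z; first by rewrite ger0_norm// lerDl expR_ge0.
  by rewrite ltr0_norm// mulrN -mulNr lerDr expR_ge0.
have key t : `|t| <= q -> \int[P]_w expR (t * (Y w - v)) <= 1 + t * (mu - v) + t ^+ 2 * C.
  move=> tq.
  have i1 : P.-integrable [set: T] (EFin \o (fun w => 1 + t * (Y w - v))).
    exact: (integrableD measurableT (finite_measure_integrable_cst P 1 measurableT)
      (integrableZl measurableT t (intYv v))).
  have i2 : P.-integrable [set: T] (EFin \o (fun w => t ^+ 2 * D * G w)).
    exact: (integrableZl measurableT (t ^+ 2 * D) intG).
  have -> : 1 + t * (mu - v) + t ^+ 2 * C =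
      \int[P]_w (1 + t * (Y w - v) + t ^+ 2 * D * G w).
    rewrite RintegralD// RintegralD//; last 2 first.
    - exact: finite_measure_integrable_cst.
    - exact: (integrableZl measurableT t (intYv v)).
    rewrite !RintegralZl// Rintegral_shift Rintegral_cst//= probability_setT mulr1.
    by rewrite mulrA.
  apply: le_Rintegral => //.
  - by apply: Lq; rewrite (le_lt_trans tq)// qr3; lra.
  - exact: (integrableD measurableT i1 i2).
  - by move=> w _; exact: dom.
have m0 : 0 < `|mu - v| by rewrite normr_gt0 subr_eq0 eq_sym.
(* The two entries ensure [e * C < 1] and [|t| <= q] respectively. *)
pose e := Num.min (C + 1)^-1 (q / `|mu - v|).
have C1 : 0 < C + 1 by lra.
have e0 : 0 < e by rewrite lt_min invr_gt0 C1 divr_gt0.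
have eC : e * C < 1.
  apply: (@le_lt_trans _ _ ((C + 1)^-1 * C)).
    by rewrite ler_wpM2r// ge_min lexx.
  by rewrite mulrC ltr_pdivrMr//; lra.
pose t := - (mu - v) * e.
have tq : `|t| <= q.
  rewrite /t normrM normrN (gtr0_norm e0) mulrC -ler_pdivlMr//.
  by rewrite ge_min lexx orbT.
apply: (@lt_le_trans _ _ ((v * t)%:E - log_mgf P Y t)%E); last exact: legendre_ge.
rewrite legendre_term_gt oppr0 expR0.
have tr : `|t| < r by rewrite (le_lt_trans tq)// qr3; lra.
rewrite -(fineK (integrable_fin_num measurableT (Lq _ tr))) lte_fin.
change (\int[P]_w expR (t * (Y w - v)) < 1).
apply: (le_lt_trans (key _ tq)).
have -> : 1 + t * (mu - v) + t ^+ 2 * C = 1 - (mu - v) ^+ 2 * e * (1 - e * C).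
  by rewrite /t; ring.
rewrite ltrBlDr ltrDl mulr_gt0 ?subr_gt0// mulr_gt0//.
by rewrite exprn_even_gt0//= subr_eq0 eq_sym.
Qed.

(** Here [v t <= mu t], so the term at [v] is below the one at the mean. Contrapositively, a
    positive term fixes the sign of [t], hence the half-line that Chernoff's inequality controls. *)
Lemma legendre_mean_term_le0 v t : 0 <= t * (mu - v) ->
  ((v * t)%:E - log_mgf P Y t <= 0)%E.
Proof.
move=> tv; apply: le_trans legendre_mean_le0.
apply: le_trans (legendre_ge mu t); rewrite leeB// lee_fin; lra.
Qed.

(** One finite value [l] at some [t > 0] gives [x <= (c + l) / t]. The other side is cut off by
    [J_X], infinite on the negative axis. *)
Lemma legendre_sublevel_bounded (c : R) :
  exists B : R, forall x, (legendre (log_mgf P Y) x <= c%:E)%E -> x <= B.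
Proof.
pose t := r / 2; have t0 : 0 < t by rewrite divr_gt0.
have tr : `|t| < r by rewrite gtr0_norm// /t ltr_pdivrMr// ltr_pMr// ltr1n.
have := Lr tr; case Lt : (log_mgf P Y t) => [l| |] // _.
- exists ((c + l) / t) => x; move/(le_trans (legendre_ge x t)).
  by rewrite Lt -EFinB lee_fin lerBlDr ler_pdivlMr.
(* With the value [-oo] the transform is [+oo], and the sublevel set is empty. *)
- exists 0 => x; move/(le_trans (legendre_ge x t)).
  by rewrite Lt.
Qed.

End finite_near_zero.

End log_mgf_legendre.

(** A supremum of functions that are affine in [x], or constantly infinite where [L t] is
    infinite. *)
Lemma lower_semicontinuous_legendre (R : realType) (L : R -> \bar R) :
  lower_semicontinuous (legendre L).
Proof.
move=> x a /ereal_sup_gt[_ [t _ <-]] alt.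
exists [set y | (a%:E < (y * t)%:E - L t)%E]; last first.
  by move=> y /= /lt_le_trans; apply; apply: ereal_sup_ubound; exists t.
case: (L t) alt => [l| |] alt.
- have : {for x, continuous (fun y : R => y * t - l)}.
    by apply: cvgB; [apply: cvgM; [exact: cvg_id|exact: cvg_cst]|exact: cvg_cst].
  rewrite -EFinB lte_fin in alt.
  by move/cvgr_gt => /(_ _ alt).
- by rewrite ltNge leNye in alt.
- by apply: filterE => y /=; exact: ltry.
Qed.

(** * Extended reals: comparison through real numbers, upper and lower limits, logarithmic scale *)

Section extended_reals.
Context (R : realType).
Implicit Types (a b : \bar R) (u : (\bar R)^nat).
Local Open Scope ereal_scope.

Lemma lt_EFin_dense a b : a < b -> exists2 c : R, a < c%:E & c%:E < b.
Proof.
case: a b => [a| |] [b| |]//.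
- rewrite lte_fin => ab; exists ((a + b) / 2)%R; rewrite lte_fin; lra.
- by exists (a + 1)%R; rewrite ?ltry// lte_fin ltrDl.
- by exists (b - 1)%R; rewrite ?ltNyr// lte_fin gtrBl.
- by exists 0%R; rewrite ?ltry ?ltNyr.
Qed.

Lemma lee_EFin_lt a b : (forall c : R, c%:E < a -> c%:E <= b) -> a <= b.
Proof.
move=> h; rewrite leNgt; apply/negP => /lt_EFin_dense[c bc ca].
by move: bc; rewrite ltNge h.
Qed.

Lemma lee_EFin_gt a b : (forall c : R, b < c%:E -> a <= c%:E) -> a <= b.
Proof.
move=> h; rewrite leNgt; apply/negP => /lt_EFin_dense[c bc ca].
by move: ca; rewrite ltNge h.
Qed.

Lemma limn_esup_near_le u b : (\forall n \near \oo, u n <= b) -> limn_esup u <= b.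
Proof.
move=> ub; rewrite limn_esup_lim; apply: lime_le; first exact: is_cvg_esups.
case: ub => N _ ub; exists N => // n /= Nn.
by apply: ge_ereal_sup => _ [k /= nk <-]; apply: ub => /=; exact: leq_trans nk.
Qed.

Lemma limn_einf_near_ge u b : (\forall n \near \oo, b <= u n) -> b <= limn_einf u.
Proof.
move=> ub; rewrite limn_einf_lim; apply: lime_ge; first exact: is_cvg_einfs.
case: ub => N _ ub; exists N => // n /= Nn.
by apply: le_ereal_inf_tmp => _ [k /= nk <-]; apply: ub => /=; exact: leq_trans nk.
Qed.

(** Passage to the logarithmic scale; [p] may be 0, where [lne] is [-oo]. *)
Lemma lne_div_le (p : \bar R) (c : R) n : (0 < n)%N -> 0 <= p ->
  p <= (expR c ^+ n)%:E -> (n%:R^-1)%:E * lne p <= c%:E.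
Proof.
move=> n0 p0 pc; rewrite lee_pdivrMl ?ltr0n//.
have -> : n%:R%:E * c%:E = lne (expR c ^+ n)%:E.
  by rewrite lne_EFin ?exprn_gt0 ?expR_gt0// -expRM_natl expRK.
by rewrite lee_lne// in_itv/= ?p0 ?leey// lee_fin exprn_ge0 ?expR_ge0.
Qed.

Lemma lne_div_ge (p : \bar R) (c : R) n : (0 < n)%N ->
  (expR c ^+ n)%:E <= p -> c%:E <= (n%:R^-1)%:E * lne p.
Proof.
move=> n0 pc; rewrite lee_pdivlMl ?ltr0n//.
have c0 : 0 <= (expR c ^+ n)%:E by rewrite lee_fin exprn_ge0 ?expR_ge0.
have -> : n%:R%:E * c%:E = lne (expR c ^+ n)%:E.
  by rewrite lne_EFin ?exprn_gt0 ?expR_gt0// -expRM_natl expRK.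
by rewrite lee_lne// in_itv/= ?c0 ?leey// (le_trans c0).
Qed.

End extended_reals.

Lemma closure_inf (R : realType) (A : set R) :
  A !=set0 -> has_lbound A -> closure A (inf A).
Proof.
move=> A0 lA B /nbhs_ballP[e /= e0 eB].
have [x Ax xe] := inf_adherent e0 (conj A0 lA).
exists x; split => //; apply: eB; rewrite /ball/= ltr_distlC.
by rewrite (lt_le_trans _ (ge_inf lA Ax)) ?xe// gtrBl.
Qed.

Lemma borel_measurable (R : realType) (G : set R) : borel G -> measurable G.
Proof.
apply: smallest_sub; first exact: sigma_algebra_measurable.
by move=> A; exact: open_measurable.
Qed.

(** * The normalized norm: rate function, upper bound and lower bound *)

Section normalized_norm.
Context d (T : measurableType d) (R : realType) (P : probability T R).
Variable X : nat -> {RV P >-> R}.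
Hypothesis iidX : iid X.
Variable r : R.
Hypothesis r0 : 0 < r.

Local Notation S := (iid_sum X (fun x : R => x ^+ 2)).
Local Notation Y := (fun w : T => X 0%N w ^+ 2).
Local Notation L := (log_mgf P Y).
Local Notation mu := (\int[P]_w (X 0%N w ^+ 2)).

Hypothesis Lr : forall t, `|t| < r -> (L t < +oo)%E.

Definition normalized_norm (n : nat) (w : T) : R :=
  norm2 (first_coords X n w) / Num.sqrt (n%:R : R).

Local Notation eta := normalized_norm.

Let mY : measurable_fun [set: T] Y.
Proof. exact: measurable_funX. Qed.

Let msq : measurable_fun [set: R] (fun x : R => x ^+ 2).
Proof. exact: exprn_measurable. Qed.

Let mu0 : 0 <= mu.
Proof. by apply: Rintegral_ge0 => w _; exact: sqr_ge0. Qed.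

Lemma norm2_first_coords n w : norm2 (first_coords X n w) = Num.sqrt (S n w).
Proof.
congr Num.sqrt; apply: eq_bigr => i _.
by rewrite mxE real_normK ?num_real.
Qed.

Lemma normalized_norm_ge0 n w : 0 <= eta n w.
Proof. by rewrite divr_ge0 ?sqrtr_ge0. Qed.

Lemma sqr_normalized_norm n w : (0 < n)%N -> n%:R * eta n w ^+ 2 = S n w.
Proof.
move=> n0; rewrite /eta norm2_first_coords expr_div_n !sqr_sqrtr ?ler0n//.
  by rewrite mulrC divfK// pnatr_eq0 -lt0n.
by apply: sumr_ge0 => i _; exact: sqr_ge0.
Qed.

Lemma measurable_normalized_norm n : measurable_fun [set: T] (eta n).
Proof.
suff mN : measurable_fun [set: T] (fun w => norm2 (first_coords X n w)).
  exact: measurable_funM mN (measurable_cst _).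
under eq_fun do rewrite norm2_first_coords.
have msqrt : measurable_fun [set: R] (@Num.sqrt R).
  by apply: continuous_measurable_fun; exact: sqrt_continuous.
exact: (measurableT_comp msqrt (measurable_iid_sum X n msq)).
Qed.

Let measurable_preimage_norm n (G : set R) : measurable G -> measurable (eta n @^-1` G).
Proof.
by move=> mG; rewrite -[_ @^-1` _]setTI; exact: measurable_normalized_norm.
Qed.

Lemma J_X_ge0 x : (0 <= J_X X x)%E.
Proof. by rewrite /J_X; case: ifP => // _; exact: legendre_log_mgf_ge0. Qed.

(** At [x >= 0] a neighbourhood is pulled back by squaring; its negative points are harmless because
    [J_X] is [+oo] there. *)
Lemma J_X_lower_semicontinuous : lower_semicontinuous (J_X X).
Proof.
move=> x a; rewrite {1}/J_X; have [x0|x0] := leP 0 x.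
  move=> /lower_semicontinuous_legendre[V xV aV].
  exists ((fun x : R => x ^+ 2) @^-1` V); first exact: (@exprn_continuous R 2 x).
  by move=> y /aV; rewrite /J_X; case: ifP => // _ _; rewrite ltry.
move=> _; exists [set y | y < 0]; first exact: lt_nbhsl.
by move=> y /= y0; rewrite /J_X leNgt y0/= ltry.
Qed.

Lemma J_X_sublevel_compact (c : R) : compact [set x | (J_X X x <= c%:E)%E].
Proof.
have [B HB] := legendre_sublevel_bounded (P := P) (Y := Y) r0 Lr c.
apply: (subclosed_compact _ (@segment_compact R 0 (1 + B))).
  rewrite (_ : [set _ | _] = ~` [set x | (c%:E < J_X X x)%E]).
    apply: open_closedC.
    by have /lower_semicontinuousP := J_X_lower_semicontinuous; exact.
  by apply/seteqP; split => x /=; rewrite leNgt => /negP.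
move=> x /=; rewrite /J_X in_itv/=; case: ifP => // x0 /HB x2B /=.
(* This gives [2 x <= 1 + x^2 <= 1 + B], with [x >= 0]. *)
have := sqr_ge0 (x - 1); rewrite sqrrB mulr1 expr1n; nra.
Qed.

(** The minimum is 0, and the Legendre transform vanishes only at the mean of the squares. *)
Lemma J_X_unique_minimizer : unique_minimizer (J_X X) (Num.sqrt mu).
Proof.
have Jm : J_X X (Num.sqrt mu) = 0%E.
  by rewrite /J_X sqrtr_ge0 sqr_sqrtr// (legendre_mean mY r0 Lr).
move=> x; split => [xmin|-> y]; last by rewrite Jm J_X_ge0.
have := xmin (Num.sqrt mu); rewrite Jm /J_X; case: ifPn => // x0 Lx.
have [<-|/(legendre_gt0 mY r0 Lr)] := eqVneq (x ^+ 2) mu.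
  by rewrite sqrtr_sqr ger0_norm.
by rewrite ltNge Lx.
Qed.

(** This is [iid_chernoff] for [t (x^2 - v)]. The sign of [t] selects the half-line: [S n w >= n v]
    for [t > 0], [S n w <= n v] for [t < 0]. *)
Lemma chernoff_normalized_norm (c t v : R) n :
    (c%:E < (v * t)%:E - L t)%E ->
  (P [set w | (t * (n%:R * v) <= t * S n w)%R] <= (expR (- c) ^+ n)%:E)%E.
Proof.
rewrite legendre_term_gt// => lt_c.
pose h (x : R) := t * (x ^+ 2 - v).
have mh : measurable_fun [set: R] h.
  by apply: measurable_funM => //; apply: measurable_funB.
have h0 : (0 <= \int[P]_w (expR (t * (X 0%N w ^+ 2 - v)))%:E)%E.
  by apply: integral_ge0 => w _; rewrite lee_fin expR_ge0.
case intE : (\int[P]_w (expR (t * (X 0%N w ^+ 2 - v)))%:E)%E h0 lt_c => [q| |]//.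
rewrite lee_fin lte_fin => q0 qc.
have := iid_chernoff iidX n mh intE.
rewrite (_ : [set w | _] = [set w | t * (n%:R * v) <= t * S n w]).
  move/le_trans; apply; rewrite lee_fin lerXn2r ?nnegrE ?expR_ge0//.
  exact: ltW.
apply: eq_set => w.
rewrite /iid_sum -mulr_sumr sumrB sumr_const card_ord mulrBr subr_ge0.
by rewrite mulr_natl.
Qed.

Lemma closed_upper_bound (F : set R) (c : R) n : closed F -> 0 <= c -> (0 < n)%N ->
    (forall x, F x -> (c%:E < J_X X x)%E) ->
  (P (eta n @^-1` F) <= (2 * expR (- c) ^+ n)%:E)%E.
Proof.
move=> clF c0 n0 FJ; pose m := Num.sqrt mu.
have m0 : 0 <= m by exact: sqrtr_ge0.
have m2 : m ^+ 2 = mu by exact: sqr_sqrtr.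
have e0 : (0 <= (expR (- c) ^+ n)%:E)%E by rewrite lee_fin exprn_ge0 ?expR_ge0.
(* The norm is nonnegative, so the negative points of [F] carry no mass; the factor 2 counts the two
   pieces. *)
pose A := F `&` `[m, +oo[; pose B := F `&` `[0, m].
have clA : closed A by apply: closedI => //; exact: interval_closed.
have clB : closed B by apply: closedI => //; exact: interval_closed.
have mS t v : measurable [set w | t * (n%:R * v) <= t * S n w].
  rewrite (_ : [set _ | _] = (fun w => t * S n w) @^-1` `[t * (n%:R * v), +oo[).
    rewrite -[_ @^-1` _]setTI; apply: measurable_funM => //.
    exact: measurable_iid_sum.
  by apply/seteqP; split => w /=; rewrite in_itv/= andbT.
(* As [c >= 0], the term at [t] is positive, which forces [t] to have the sign of [x^2 - mu]. *)
have tilt_exists x : F x -> 0 <= x -> exists t : R,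
    (c%:E < (x ^+ 2 * t)%:E - L t)%E /\ t * (mu - x ^+ 2) < 0.
  move=> Fx x0; have := FJ _ Fx; rewrite /J_X x0 => /ereal_sup_gt[_ [t _ <-]] ct.
  exists t; split => //; rewrite ltNge; apply/negP.
  move/(legendre_mean_term_le0 mY r0 Lr); rewrite leNgt => /negP; apply.
  by apply: le_lt_trans ct; rewrite lee_fin.
have PA : (P (eta n @^-1` A) <= (expR (- c) ^+ n)%:E)%E.
  have [->|A0] := eqVneq A set0; first by rewrite preimage_set0 measure0.
  have lbA : has_lbound A by exists m => x [_ /=]; rewrite in_itv/= andbT.
  (* The point of [A] nearest to [m]; the tilt found there serves all of [A]. *)
  have Ab : A (inf A).
    by apply: clA; apply: closure_inf => //; exact/set0P.
  have [Fb /=] := Ab; rewrite in_itv/= andbT => mb.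
  have b0 : 0 <= inf A := le_trans m0 mb.
  have [t [ct tneg]] := tilt_exists _ Fb b0.
  have t0 : 0 < t.
    have : mu - inf A ^+ 2 <= 0 by rewrite -m2 subr_le0 lerXn2r ?nnegrE.
    by move=> h; rewrite ltNge; apply/negP => t0; move: tneg; rewrite ltNge mulr_le0.
  apply: le_trans (chernoff_normalized_norm n ct).
  apply: le_measure; rewrite ?inE//.
    by apply: measurable_preimage_norm; exact: closed_measurable.
  move=> w /= /(ge_inf lbA) bw.
  rewrite ler_pM2l// -sqr_normalized_norm// ler_wpM2l//.
  by rewrite lerXn2r ?nnegrE ?normalized_norm_ge0.
have PB : (P (eta n @^-1` B) <= (expR (- c) ^+ n)%:E)%E.
  have [->|B0] := eqVneq B set0; first by rewrite preimage_set0 measure0.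
  have ubB : has_ubound B by exists m => x [_ /=]; rewrite in_itv/= => /andP[].
  have Ba : B (sup B).
    by apply: clB; apply: closure_sup => //; exact/set0P.
  have [Fa /=] := Ba; rewrite in_itv/= => /andP[a0 am].
  have [t [ct tneg]] := tilt_exists _ Fa a0.
  have t0 : t < 0.
    have : 0 <= mu - sup B ^+ 2 by rewrite -m2 subr_ge0 lerXn2r ?nnegrE.
    by move=> h; rewrite ltNge; apply/negP => t0; move: tneg; rewrite ltNge mulr_ge0.
  apply: le_trans (chernoff_normalized_norm n ct).
  apply: le_measure; rewrite ?inE//.
    by apply: measurable_preimage_norm; exact: closed_measurable.
  move=> w /= /(ub_le_sup ubB) aw.
  rewrite ler_nM2l// -sqr_normalized_norm// ler_wpM2l//.
  by rewrite lerXn2r ?nnegrE ?normalized_norm_ge0.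
have mA : measurable (eta n @^-1` A).
  by apply: measurable_preimage_norm; exact: closed_measurable.
have mB : measurable (eta n @^-1` B).
  by apply: measurable_preimage_norm; exact: closed_measurable.
apply: (@le_trans _ _ (P (eta n @^-1` A `|` eta n @^-1` B))).
  apply: le_measure; rewrite ?inE; [|exact: measurableU|].
    by apply: measurable_preimage_norm; exact: closed_measurable.
  move=> w /= Fw; have := normalized_norm_ge0 n w => w0.
  have [mw|mw] := leP m (eta n w); [left|right]; split => //=.
    by rewrite in_itv/= mw.
  by rewrite in_itv/= w0 ltW.
apply: le_trans (measureU2 P mA mB) _.
by rewrite mulr_natl mulr2n EFinD leeD.
Qed.

(** By continuity of the square root at [x^2], [G] contains every [y >= 0] with [y^2] close to
    [x^2]. It thus suffices that [S n] is within [n delta] of [n x^2], which is the ball estimate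
    with [alpha = e^(- a)]. *)
Lemma open_lower_bound (G : set R) (x a : R) : measurable G -> G° x ->
    (J_X X x < a%:E)%E ->
  \forall n \near \oo, ((expR (- a) ^+ n)%:E <= P (eta n @^-1` G))%E.
Proof.
move=> mG Gx; rewrite /J_X; case: ifPn => // x0 Ja.
have [delta delta0 dG] : exists2 delta : R, 0 < delta &
    forall y, 0 <= y -> `|y ^+ 2 - x ^+ 2| < delta -> G y.
  have : nbhs (x ^+ 2) (Num.sqrt @^-1` G).
    have := @sqrt_continuous R (x ^+ 2); apply.
    by rewrite sqrtr_sqr ger0_norm.
  move=> /nbhs_ballP[e /= e0 eG]; exists e => // y y0 ye.
  have := eG (y ^+ 2); rewrite /ball/= distrC => /(_ ye).
  by rewrite sqrtr_sqr ger0_norm.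
have lt_a t : ((expR (- a))%:E < \int[P]_w (expR (t * (X 0%N w ^+ 2 - x ^+ 2)))%:E)%E.
  rewrite -legendre_term_lt//; apply: le_lt_trans Ja; exact: legendre_ge.
have mh : measurable_fun [set: R] (fun y : R => y ^+ 2 - x ^+ 2).
  exact: measurable_funB.
have ball_le := near_iid_sum_ball iidX mh (expR_gt0 (- a)) delta0 lt_a.
near=> n.
have n0 : (0 < n)%N by near: n; exact: nbhs_infty_gt.
apply: (@le_trans _ _ (P [set w |
    `|iid_sum X (fun y => y ^+ 2 - x ^+ 2) n w| < n%:R * delta])).
  by near: n; exact: ball_le.
apply: le_measure; rewrite ?inE.
- exact: measurable_iid_sum_ball.
- exact: measurable_preimage_norm.
move=> w /=; rewrite /iid_sum sumrB sumr_const card_ord -/(S n w).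
rewrite -sqr_normalized_norm// -[x ^+ 2 *+ n]mulr_natl -mulrBr normrM ger0_norm//.
rewrite ltr_pM2l ?ltr0n// => /dG; apply; exact: normalized_norm_ge0.
Unshelve. all: by end_near. Qed.

Lemma LDP_normalized_norm : LDP P (fun n : nat => n%:R : R) eta (J_X X).
Proof.
split.
- by split=> [n n0|]; [rewrite ltr0n|exact: cvgr_idn].
- by move=> n G /borel_measurable; exact: measurable_preimage_norm.
- by split; [exact: J_X_ge0|exact: J_X_lower_semicontinuous].
move=> G /borel_measurable mG; split; last 2 first.
- exact: limn_einf_sup.
- rewrite leeNr; apply: lee_EFin_lt => c cJ; rewrite leeNr; apply: limn_esup_near_le.
  have le_exp : \forall n \near \oo, (P (eta n @^-1` G) <= (expR (- c) ^+ n)%:E)%E.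
    (* For [c < 0] the right side is at least 1. *)
    have [c0|c0] := ltP c 0.
      near=> n; apply: (@le_trans _ _ 1%:E).
        by apply: probability_le1; exact: measurable_preimage_norm.
      by rewrite lee_fin exprn_ege1// -expR0 ler_expR oppr_ge0 ltW.
    (* The margin between [c] and [c'] absorbs the factor 2 of the bound for closed sets. *)
    have [c' cc' c'J] := lt_EFin_dense cJ; rewrite lte_fin in cc'.
    have pow : 0 <= expR (- c') < expR (- c).
      by rewrite expR_ge0 ltr_expR ltrN2.
    have pow0 : 0 <= (0 : R) < expR (- c) by rewrite lexx expR_gt0.
    have near_le := near_exprn_lt pow0 pow (ler0n R 2).
    near=> n.
    have n0 : (0 < n)%N by near: n; exact: nbhs_infty_gt.
    have : 0 ^+ n + 2 * expR (- c') ^+ n <= expR (- c) ^+ n.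
      by near: n; exact: near_le.
    rewrite expr0n gtn_eqF// add0r -lee_fin; apply: le_trans.
    apply: (@le_trans _ _ (P (eta n @^-1` closure G))).
      apply: le_measure; rewrite ?inE; [exact: measurable_preimage_norm| |].
        apply: measurable_preimage_norm; apply: closed_measurable.
        exact: closed_closure.
      by apply: preimage_subset; exact: subset_closure.
    apply: closed_upper_bound => //; first exact: closed_closure.
      exact: le_trans (ltW cc').
    move=> x Gx; apply: (lt_le_trans c'J); apply: ereal_inf_lbound.
    by exists x.
  near=> n; rewrite -EFinN; apply: lne_div_le.
  + by near: n; exact: nbhs_infty_gt.
  + exact: measure_ge0.
  + by near: n; exact: le_exp.
rewrite leeNl; apply: le_ereal_inf_tmp => _ [x Gx <-].
apply: lee_EFin_gt => a Ja; rewrite leeNl; apply: limn_einf_near_ge.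
have ge_exp := open_lower_bound mG Gx Ja.
near=> n; rewrite -EFinN; apply: lne_div_ge.
- by near: n; exact: nbhs_infty_gt.
- by near: n; exact: ge_exp.
Unshelve. all: by end_near. Qed.

End normalized_norm.

Theorem lemma3p1 (d : measure_display) (T : measurableType d) (R : realType)
    (P : probability T R) (X : nat -> {RV P >-> R}) :
  iid X ->
  (exists2 r : R, 0 < r &
     forall t : R, ball (0 : R) r t ->
       (log_mgf P (fun w => X 0%N w ^+ 2)%R t < +oo)%E) ->
  [/\ LDP P (fun n : nat => n%:R : R)
        (fun (n : nat) (w : T) =>
           norm2 (first_coords X n w) / Num.sqrt (n%:R : R))
        (J_X X),
      good_rate_function (J_X X) &
      exists2 m : R,
        m%:E = sqrte 'E_P[fun w => `|X 0%N w| ^+ 2] &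
        unique_minimizer (J_X X) m].
Proof.
move=> iidX [r r0 Lball].
have Lr t : `|t| < r -> (log_mgf P (fun w => X 0%N w ^+ 2)%R t < +oo)%E.
  by move=> tr; apply: Lball; rewrite /ball/= sub0r normrN.
split.
- exact: (LDP_normalized_norm iidX r0 Lr).
- split; last by move=> c; exact: (J_X_sublevel_compact r0 Lr).
  by split; [exact: J_X_ge0|exact: J_X_lower_semicontinuous].
exists (Num.sqrt (\int[P]_w (X 0%N w ^+ 2))); last first.
  exact: (J_X_unique_minimizer r0 Lr).
have mY : measurable_fun [set: T] (fun w => X 0%N w ^+ 2).
  exact: measurable_funX.
(* The expectation is an extended real; integrability makes it finite, so that [sqrte] is the real
   square root. *)
rewrite unlock; under eq_integral do rewrite real_normK ?num_real//.
by rewrite -(fineK (integrable_fin_num measurableT (integrable_log_mgf mY r0 Lr))).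
Qed.
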